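(* Let $n,a>0$ and $m\ge 0$ be integers. Consider three registers $\psi$, $\varphi$, $\alpha$ of $n$, $m$ and $a$ qubits respectively (with $\alpha$ the auxiliary register). Let $P$ be a permutation gate on $a$ qubits, $D$ a diagonal gate on $a$ qubits, and $U$ an arbitrary unitary on $m$ qubits. Let $W$ be the unitary on the $n+m+a$ qubits obtained by applying, in this order: (1) $C^n_\psi P_\alpha$, the gate $P$ on $\alpha$ controlled by all $n$ qubits of $\psi$; (2) $D_\alpha$, the gate $D$ on $\alpha$; (3) $C^a_\alpha U_\varphi$, the gate $U$ on $\varphi$ controlled by all $a$ qubits of $\alpha$; (4) $C^n_\psi P^\dagger_\alpha$, the gate $P^\dagger$ on $\alpha$ controlled by all $n$ qubits of $\psi$; that is, $$W=(C^n_\psi P^\dagger_\alpha)\,(C^a_\alpha U_\varphi)\,(D_\alpha)\,(C^n_\psi P_\alpha),$$ each factor being extended by the identity on the registers it does not mention. If the auxiliary register is initialized in $|\alpha\rangle=|0\cdots0\rangle$, then after the full sequence of operations it has returned to its initial state, unentangled with the other registers: for all states $|\psi\rangle$ of $n$ qubits and $|\varphi\rangle$ of $m$ qubits there is a state $|\nu\rangle$ of the $n+m$ qubits of registers $\psi,\varphi$ such that $$W\big(|\psi\rangle\otimes|\varphi\rangle\otimes|0\cdots0\rangle\big)=|\nu\rangle\otimes|0\cdots0\rangle .$$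
   Context: All matrices are with respect to the computational basis $\{|k\rangle\}$ of the relevant qubits, where $|k\rangle$, $0\le k\le 2^q-1$, denotes the $q$-qubit basis state given by the binary expansion of $k$; thus $|0\rangle=|0\cdots 0\rangle$ and $|2^q-1\rangle=|1\cdots1\rangle$. A register with $m=0$ qubits has state space $\mathbb{C}$. A permutation gate is a unitary whose matrix has exactly one non-zero entry in each row and each column (the non-zero entries may be arbitrary complex phases). A diagonal gate is a unitary whose matrix has non-zero entries only on the main diagonal. For a unitary $V$ on a target register, the gate controlled by $c$ control qubits is $$C^cV=\sum_{k=0}^{2^c-2}|k\rangle\langle k|\otimes I+|2^c-1\rangle\langle 2^c-1|\otimes V,$$ where the first tensor factor is the control register and the second is the target register: $V$ is applied exactly when all control qubits are in state $|1\rangle$. Subscripts as in $C^n_\psi P_\alpha$ indicate that the controls are the qubits of register $\psi$ and the target is register $\alpha$. *)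

(* Defs.v *)
From mathcomp Require Import all_boot all_order all_algebra.
From mathcomp Require Import reals.
From mathcomp Require Export complex mxtens.

Set Implicit Arguments.
Unset Strict Implicit.
Unset Printing Implicit Defensive.

Import GRing.Theory Num.Theory.
Local Open Scope ring_scope.
Local Open Scope sesquilinear_scope.

(* A register of q qubits has state space C^(2^q), its basis being indexed by  *)
(* 'I_(2^q) through binary expansion (most significant qubit first), and       *)
(* juxtaposition of registers is the Kronecker product A *t B of mxtens.       *)

Section Gates.
Variable C : numClosedFieldType.

Definition is_state d (v : 'cV[C]_d) : Prop := v^t* *m v = 1%:M.

(* |k>, used only for k < 2^q (it is the zero vector otherwise). *)
Definition ket q (k : nat) : 'cV[C]_(2 ^ q) := \col_i (i == k :> nat)%:R.

Definition ketbra q (k : nat) : 'M[C]_(2 ^ q) := ket q k *m (ket q k)^t*.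

Definition permutation_gate d (P : 'M[C]_d) : Prop :=
  [/\ P \is unitarymx,
      forall i, exists! j, P i j != 0
    & forall j, exists! i, P i j != 0].

Definition diagonal_gate d (D : 'M[C]_d) : Prop :=
  D \is unitarymx /\ is_diag_mx D.

Definition controlled c d (V : 'M[C]_d) : 'M[C]_(2 ^ c * d) :=
  \sum_(0 <= k < 2 ^ c - 1) ketbra c k *t 1%:M + ketbra c (2 ^ c - 1) *t V.

(* Extensions by the identity to three registers of dimensions d1, d2, d3 of   *)
(* an operator on two of them: the first tensor factor of A acts on register 1 *)
(* (resp. 3) and the second one on register 3 (resp. 2).                       *)
Definition extend13 d1 d2 d3 (A : 'M[C]_(d1 * d3)) : 'M[C]_(d1 * d2 * d3) :=
  \matrix_(x, y)
    let: (x12, x3) := mxtens_unindex x in let: (x1, x2) := mxtens_unindex x12 in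
    let: (y12, y3) := mxtens_unindex y in let: (y1, y2) := mxtens_unindex y12 in
    A (mxtens_index (x1, x3)) (mxtens_index (y1, y3)) * (x2 == y2)%:R.

Definition extend32 d1 d2 d3 (A : 'M[C]_(d3 * d2)) : 'M[C]_(d1 * d2 * d3) :=
  \matrix_(x, y)
    let: (x12, x3) := mxtens_unindex x in let: (x1, x2) := mxtens_unindex x12 in
    let: (y12, y3) := mxtens_unindex y in let: (y1, y2) := mxtens_unindex y12 in
    A (mxtens_index (x3, x2)) (mxtens_index (y3, y2)) * (x1 == y1)%:R.

Lemma extend13_tens d1 d2 d3 (A : 'M[C]_d1) (B : 'M[C]_d3) :
  extend13 d2 (A *t B) = A *t (1%:M : 'M_d2) *t B.
Proof.
apply/matrixP => x y.
case: (mxtens_indexP x) => x12 x3; case: (mxtens_indexP x12) => x1 x2.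
case: (mxtens_indexP y) => y12 y3; case: (mxtens_indexP y12) => y1 y2.
by rewrite mxE !mxtens_indexK !tensmxE mxE mulrAC.
Qed.

Lemma extend32_tens d1 d2 d3 (A : 'M[C]_d3) (B : 'M[C]_d2) :
  extend32 d1 (A *t B) = (1%:M : 'M_d1) *t B *t A.
Proof.
apply/matrixP => x y.
case: (mxtens_indexP x) => x12 x3; case: (mxtens_indexP x12) => x1 x2.
case: (mxtens_indexP y) => y12 y3; case: (mxtens_indexP y12) => y1 y2.
rewrite mxE !mxtens_indexK !tensmxE mxE [LHS]mulrC -mulrA.
by congr (_ * _); exact: mulrC.
Qed.

(* Registers psi (n qubits), phi (m qubits), alpha (a qubits), in this order. *)
Definition W n m a (P D : 'M[C]_(2 ^ a)) (U : 'M[C]_(2 ^ m)) :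
    'M[C]_(2 ^ n * 2 ^ m * 2 ^ a) :=
  extend13 (2 ^ m) (controlled n (P^t*))
    *m extend32 (2 ^ n) (controlled a U)
    *m ((1%:M : 'M_(2 ^ n * 2 ^ m)) *t D)
    *m extend13 (2 ^ m) (controlled n P).

End Gates.

Arguments ket {C} q k.
Arguments ketbra {C} q k.
Arguments controlled {C} c {d} V.
Arguments W {C} n {m a} P D U.

(* Main.v *)
Require Import Defs.
From mathcomp Require Import all_boot all_order all_algebra.
From mathcomp Require Import reals.

Local Open Scope ring_scope.

(** Because [P] is a permutation gate, [P|0>] is a multiple of some basis state
    [|j>].  The gates [D] and [C^a U] fix each basis state [|k>] of the auxiliary
    register up to a unitary [V_k] acting on [phi].  So the component of [psi]
    orthogonal to [|1...1>] sees [V_0] with the register staying in [|0>], while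
    the component along [|1...1>] sees [V_j] with the register in [P|0>], which
    [P^dagger] maps back to [|0>]. *)

Import GRing.Theory Num.Theory.
Local Open Scope sesquilinear_scope.

Section Tensor.
Variable R : comPzRingType.

Lemma tensmxDl m n p q (A B : 'M[R]_(m, n)) (M : 'M[R]_(p, q)) :
  (A + B) *t M = A *t M + B *t M.
Proof. by apply/matrixP => i j; rewrite !mxE mulrDl. Qed.

Lemma tensmxZl m n p q a (A : 'M[R]_(m, n)) (M : 'M[R]_(p, q)) :
  (a *: A) *t M = a *: (A *t M).
Proof. by apply/matrixP => i j; rewrite !mxE mulrA. Qed.

Lemma tensmxZr m n p q a (A : 'M[R]_(m, n)) (M : 'M[R]_(p, q)) :
  A *t (a *: M) = a *: (A *t M).
Proof. by apply/matrixP => i j; rewrite !mxE mulrCA. Qed.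

Lemma tensmx_suml m n p q I (r : seq I) (F : I -> 'M[R]_(m, n))
    (M : 'M[R]_(p, q)) :
  (\sum_(i <- r) F i) *t M = \sum_(i <- r) F i *t M.
Proof.
by elim/big_rec2: _ => [|i A B _ <-]; rewrite ?tens0mx ?tensmxDl.
Qed.

Lemma tensmx1 m n : (1%:M : 'M[R]_m) *t (1%:M : 'M[R]_n) = 1%:M.
Proof.
apply/matrixP => x y.
case: (mxtens_indexP x) => i j; case: (mxtens_indexP y) => k l.
rewrite tensmxE !mxE (can_eq (@mxtens_indexK _ _)) xpair_eqE.
by rewrite -natrM mulnb.
Qed.

End Tensor.

Section Registers.
Variable C : numClosedFieldType.

Lemma adjmx_tens m n p q (A : 'M[C]_(m, n)) (B : 'M[C]_(p, q)) :
  (A *t B)^t* = A^t* *t B^t*.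
Proof. by rewrite trmx_tens map_mxT. Qed.

Lemma adjmx_mul m n p (A : 'M[C]_(m, n)) (B : 'M[C]_(n, p)) :
  (A *m B)^t* = B^t* *m A^t*.
Proof. by rewrite trmx_mul map_mxM. Qed.

Lemma unitarymx_adjmulmx d (V : 'M[C]_d) : V \is unitarymx -> V^t* *m V = 1%:M.
Proof. by move/unitarymxP/mulmx1C. Qed.

Lemma is_state_mulmx d (V : 'M[C]_d) (v : 'cV[C]_d) :
  V \is unitarymx -> is_state v -> is_state (V *m v).
Proof.
move=> /unitarymx_adjmulmx uV sv.
by rewrite /is_state adjmx_mul mulmxA -(mulmxA _ _ V) uV mulmx1.
Qed.

Lemma is_state_tens d e (v : 'cV[C]_d) (w : 'cV[C]_e) :
  is_state v -> is_state w -> is_state (v *t w : 'cV[C]_(d * e)).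
Proof.
rewrite /is_state => sv sw.
(* Both squared norms live in ['M_1] and their tensor product in ['M_(1 * 1)]; the two types are
   convertible. *)
have := tensmx_mul (v^t*) (w^t*) v w; rewrite sv sw tensmx1 -adjmx_tens; exact.
Qed.

Lemma ket_delta q (i : 'I_(2 ^ q)) : ket q i = delta_mx i 0 :> 'cV[C]_(2 ^ q).
Proof. by apply/matrixP => j k; rewrite !mxE (ord1 k) eqxx andbT. Qed.

Lemma ketbra_delta q (i : 'I_(2 ^ q)) :
  ketbra q i = delta_mx i i :> 'M[C]_(2 ^ q).
Proof.
rewrite /ketbra ket_delta trmx_delta.
have -> : map_mx Num.conj (delta_mx 0 i) = delta_mx 0 i :> 'rV[C]_(2 ^ q).
  by apply/matrixP => j k; rewrite !mxE rmorph_nat.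
by rewrite mul_delta_mx.
Qed.

Lemma adjmx_ketbra q k : (ketbra q k)^t* = ketbra q k :> 'M[C]_(2 ^ q).
Proof. by rewrite /ketbra adjmx_mul trmxCK. Qed.

(** Reversing the index 0 gives a value that reduces to [2 ^ q - 1], so [ketbra q (ones q)] and
    [proj_ones q] are convertible. *)
Definition ones q : 'I_(2 ^ q) := rev_ord (Ordinal (expn_gt0 2 q)).

Definition proj_ones q : 'M[C]_(2 ^ q) := ketbra q (2 ^ q - 1).

Lemma proj_onesE q : proj_ones q = delta_mx (ones q) (ones q).
Proof. by rewrite -ketbra_delta. Qed.

Lemma proj_ones_ket q (i : 'I_(2 ^ q)) :
  proj_ones q *m ket q i = (if i == ones q then ket q i else 0) :> 'cV[C]_(2 ^ q).
Proof.
rewrite proj_onesE ket_delta mul_delta_mx_cond eq_sym.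
by case: eqP => [->|]; rewrite ?mulr1n ?mulr0n.
Qed.

Lemma proj_ones_idem q : proj_ones q *m proj_ones q = proj_ones q.
Proof. by rewrite proj_onesE mul_delta_mx. Qed.

Lemma sum_ketbra q : \sum_(0 <= k < 2 ^ q) ketbra q k = 1%:M :> 'M[C]_(2 ^ q).
Proof.
rewrite big_mkord mx1_sum_delta; apply: eq_bigr => i _; exact: ketbra_delta.
Qed.

(** Completeness of the basis: the projectors on all basis states but the last add up to the
    complement of [proj_ones c], so two terms replace the long sum. *)
Lemma controlledE c d (V : 'M[C]_d) :
  controlled c V = (1%:M - proj_ones c) *t 1%:M + proj_ones c *t V.
Proof.
rewrite /controlled -tensmx_suml -sum_ketbra /proj_ones; congr (_ *t _ + _).
have pos : (0 < 2 ^ c)%N by rewrite expn_gt0.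
(* From [2 ^ c - 1] on, the full sum has a single term left, which cancels the subtracted
   projector. *)
rewrite [in RHS](@big_cat_nat _ _ _ (2 ^ c - 1)) ?leq_subr //=.
rewrite subn1 [X in _ + X - _]big_ltn ?prednK //.
by rewrite [X in _ + (_ + X)]big_geq // addr0 addrK.
Qed.

Lemma extend13D d1 d2 d3 (A B : 'M[C]_(d1 * d3)) :
  extend13 d2 (A + B) = extend13 d2 A + extend13 d2 B.
Proof.
apply/matrixP => x y.
case: (mxtens_indexP x) => x12 x3; case: (mxtens_indexP x12) => x1 x2.
case: (mxtens_indexP y) => y12 y3; case: (mxtens_indexP y12) => y1 y2.
by rewrite !mxE !mxtens_indexK mxE mulrDl.
Qed.

Lemma extend32D d1 d2 d3 (A B : 'M[C]_(d3 * d2)) :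
  extend32 d1 (A + B) = extend32 d1 A + extend32 d1 B.
Proof.
apply/matrixP => x y.
case: (mxtens_indexP x) => x12 x3; case: (mxtens_indexP x12) => x1 x2.
case: (mxtens_indexP y) => y12 y3; case: (mxtens_indexP y12) => y1 y2.
by rewrite !mxE !mxtens_indexK mxE mulrDl.
Qed.

Lemma extend13_controlled_tens c d2 d3 p q r (V : 'M[C]_d3)
    (x : 'M[C]_(2 ^ c, p)) (y : 'M[C]_(d2, q)) (z : 'M[C]_(d3, r)) :
  extend13 d2 (controlled c V) *m (x *t y *t z) =
  ((1%:M - proj_ones c) *m x) *t y *t z + (proj_ones c *m x) *t y *t (V *m z).
Proof.
rewrite controlledE; set Q := _ - _.
by rewrite extend13D !extend13_tens mulmxDl !tensmx_mul !mul1mx.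
Qed.

(** On a basis state of the control register, one of the two complementary projectors gives 0 and
    the other the state itself, so a product stays a product. *)
Lemma extend32_controlled_tens c d1 d2 p q (V : 'M[C]_d2)
    (x : 'M[C]_(d1, p)) (y : 'M[C]_(d2, q)) (i : 'I_(2 ^ c)) :
  extend32 d1 (controlled c V) *m (x *t y *t ket c i) =
  x *t ((if i == ones c then V else 1%:M) *m y) *t ket c i.
Proof.
rewrite controlledE extend32D !extend32_tens mulmxDl !tensmx_mul !mul1mx.
rewrite mulmxBl mul1mx proj_ones_ket; case: eqP => _.
  by rewrite subrr tensmx0 add0r.
by rewrite subr0 tensmx0 addr0 mul1mx.
Qed.

Lemma diag_mul_ket q (D : 'M[C]_(2 ^ q)) (i : 'I_(2 ^ q)) :
  is_diag_mx D -> D *m ket q i = D i i *: ket q i.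
Proof.
move=> /is_diag_mxP dD; rewrite ket_delta -colE.
apply/matrixP => j k; rewrite !mxE (ord1 k) eqxx andbT.
by case: (j =P i) => [->|/eqP /dD ->]; rewrite ?mulr1 ?mulr0.
Qed.

(** Row [i] of [D] is zero off the diagonal, so the [(i, i)] entry of [D *m D^t*] reduces to this
    one product. *)
Lemma diagonal_gate_entry d (D : 'M[C]_d) (i : 'I_d) :
  diagonal_gate D -> D i i * (D i i)^* = 1.
Proof.
case=> /unitarymxP /matrixP /(_ i i) + /is_diag_mxP dD.
rewrite !mxE eqxx (bigD1 i) //= big1 ?addr0 ?mxE // => j ji.
by rewrite dD 1?eq_sym // mul0r.
Qed.

Lemma unitarymxZ d a (V : 'M[C]_d) :
  a * a^* = 1 -> V \is unitarymx -> a *: V \is unitarymx.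
Proof.
move=> a1 /unitarymxP uV; apply/unitarymxP.
by rewrite linearZ /= map_mxZ -scalemxAl -scalemxAr scalerA a1 scale1r uV.
Qed.

(** [P *m ket a 0] is column 0 of [P]; [j] is the row of its unique non-zero entry and [b] is that
    entry. *)
Lemma permutation_gate_ket0 a (P : 'M[C]_(2 ^ a)) : permutation_gate P ->
  exists (j : 'I_(2 ^ a)) (b : C), P *m ket a 0 = b *: ket a j.
Proof.
pose i0 := Ordinal (expn_gt0 2 a).
case=> _ _ /(_ i0) [j [_ uj]]; exists j, (P j i0).
rewrite (ket_delta _ i0) ket_delta -colE; apply/matrixP => i k.
rewrite !mxE (ord1 k) eqxx andbT; case: eqP => [->|ij]; rewrite ?mulr1 ?mulr0 //.
by apply/eqP; apply: contraT => /uj /esym.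
Qed.

(** [V] depends on [i] alone and serves all [x], [y] and [b]. The scalar [b] is carried along so
    that the result applies to the image of the zero state under [P]. *)
Lemma controlled_diag_mul_tens c d1 d2 (D : 'M[C]_(2 ^ c)) (U : 'M[C]_d2)
    (i : 'I_(2 ^ c)) :
  diagonal_gate D -> U \is unitarymx ->
  exists2 V : 'M[C]_d2, V \is unitarymx &
    forall p q (x : 'M[C]_(d1, p)) (y : 'M[C]_(d2, q)) (b : C),
    extend32 d1 (controlled c U)
      *m (((1%:M : 'M_(d1 * d2)) *t D) *m (x *t y *t (b *: ket c i))) =
    x *t (V *m y) *t (b *: ket c i).
Proof.
(* The phase that [D] gives to the basis state is moved onto the target register, leaving the
   auxiliary factor unchanged. *)
move=> gD uU; exists (D i i *: (if i == ones c then U else 1%:M)).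
  apply: unitarymxZ; first exact: diagonal_gate_entry.
  case: ifP => // _; apply/unitarymxP.
  by rewrite trmx1 map_mx1 mulmx1.
case: gD => _ dD p q x y b.
rewrite tensmx_mul mul1mx -scalemxAr diag_mul_ket // !tensmxZr -!scalemxAr.
by rewrite extend32_controlled_tens -scalemxAl tensmxZr tensmxZl.
Qed.

(** In the product with the adjoint, the cross terms vanish by orthogonality of the two projectors,
    and the remaining terms add up to the identity. *)
Lemma unitarymx_multiplexer q d (V0 V1 : 'M[C]_d) :
  V0 \is unitarymx -> V1 \is unitarymx ->
  (1%:M - proj_ones q) *t V0 + proj_ones q *t V1 \is unitarymx.
Proof.
move=> /unitarymxP u0 /unitarymxP u1; apply/unitarymxP.
rewrite linearD /= map_mxD !adjmx_tens linearB /= map_mxB trmx1 map_mx1.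
rewrite adjmx_ketbra -/(proj_ones q) mulmxDl !mulmxDr !tensmx_mul u0 u1.
rewrite !mulmxBl !mulmxBr !mul1mx !mulmx1 proj_ones_idem !subrr !tens0mx.
by rewrite subr0 addr0 add0r -tensmxDl subrK tensmx1.
Qed.

End Registers.

Theorem theorem3 (R : realType) (n m a : nat) (hn : (0 < n)%N) (ha : (0 < a)%N)
    (P D : 'M[R[i]]_(2 ^ a)) (U : 'M[R[i]]_(2 ^ m))
    (hP : permutation_gate P) (hD : diagonal_gate D) (hU : U \is unitarymx)
    (psi : 'cV[R[i]]_(2 ^ n)) (phi : 'cV[R[i]]_(2 ^ m))
    (hpsi : is_state psi) (hphi : is_state phi) :
  exists nu : 'cV[R[i]]_(2 ^ n * 2 ^ m),
    is_state nu /\ W n P D U *m (psi *t phi *t ket a 0) = nu *t ket a 0.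
Proof.
have uP : P^t* *m P = 1%:M by case: hP => /unitarymx_adjmulmx.
have [j [b Pj]] := permutation_gate_ket0 _ _ _ hP.
pose i0 := Ordinal (expn_gt0 2 a).
have [V0 uV0 E0] := controlled_diag_mul_tens _ _ (2 ^ n) _ _ _ i0 hD hU.
have [V1 uV1 E1] := controlled_diag_mul_tens _ _ (2 ^ n) _ _ _ j hD hU.
set p := proj_ones R[i] n; set p' : 'M_(2 ^ n) := 1%:M - p.
(* The witness comes from a unitary that applies [V0] or [V1] to [phi] according to [psi], which
   makes it a state. *)
exists ((p' *t V0 + p *t V1) *m (psi *t phi)); split.
  apply: is_state_mulmx; first exact: unitarymx_multiplexer.
  exact: is_state_tens.
have {}E0 x y := E0 1 1 x y 1; rewrite scale1r /= in E0.
have -> : (p' *t V0 + p *t V1) *m (psi *t phi) =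
    (p' *m psi) *t (V0 *m phi) + (p *m psi) *t (V1 *m phi).
  by rewrite mulmxDl !tensmx_mul.
rewrite /W -3!mulmxA extend13_controlled_tens -/p -/p' !mulmxDr.
(* [E1] needs the explicit form [b *: ket a j]; folding it back into [P *m ket a 0] lets the final
   [P^t*] cancel [P]. *)
rewrite E0 Pj E1 -Pj !extend13_controlled_tens -/p -/p' !(mulmxA _ _ psi).
(* The last controlled gate splits each of the two branches again; of the four terms, those with
   mixed projectors vanish. *)
have pp : p *m p = p by exact: proj_ones_idem.
have pp' : p *m p' = 0 by rewrite mulmxBr mulmx1 pp subrr.
have p'p : p' *m p = 0 by rewrite mulmxBl mul1mx pp subrr.
have p'p' : p' *m p' = p' by rewrite [LHS]mulmxBl mul1mx pp' subr0.
rewrite pp pp' p'p p'p' !mul0mx !tens0mx addr0 add0r mulmxA uP mul1mx.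
by rewrite tensmxDl.
Qed.
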